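(* For every uncountable cardinal $\kappa$ there is a graph $G$ that does not have the $\kappa$-Erdős–Pósa property; that is, there is a graph $\Gamma$ such that $\Gamma$ does not contain $\kappa$ pairwise disjoint subgraphs isomorphic to $G$, yet for every $X\subseteq V(\Gamma)$ with $|X|<\kappa$ the graph $\Gamma-X$ contains a subgraph isomorphic to $G$.
   Context: Graphs may be infinite. *)

(* Defs.v *)
From mathcomp Require Import all_boot.
From mathcomp Require Import boolp classical_sets functions cardinality.

Set Implicit Arguments.
Unset Strict Implicit.
Unset Printing Implicit Defensive.

Local Open Scope classical_set_scope.
Local Open Scope card_scope.

(* Simple undirected graphs on a vertex set of arbitrary cardinality. *)
Record graph := Graph {
  vertex :> Type;
  adj : vertex -> vertex -> Prop;
  adj_sym : forall x y, adj x y -> adj y x;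
  adj_irrefl : forall x, ~ adj x x }.

(* Not necessarily induced: [sub_adj] may omit edges between vertices of
   [sub_vertex]. *)
Record subgraph (G : graph) := Subgraph {
  sub_vertex : set G;
  sub_adj : G -> G -> Prop;
  sub_adj_adj : forall x y, sub_adj x y -> adj x y;
  sub_adj_sym : forall x y, sub_adj x y -> sub_adj y x;
  sub_adj_vertex : forall x y, sub_adj x y -> sub_vertex x }.

Definition graph_of_subgraph (G : graph) (H : subgraph G) : graph :=
  @Graph (sub_vertex H) (fun x y => sub_adj H (val x) (val y))
    (fun x y => @sub_adj_sym G H (val x) (val y))
    (fun x hx => @adj_irrefl G (val x) (sub_adj_adj hx)).
Coercion graph_of_subgraph : subgraph >-> graph.

Definition delete_vertices (G : graph) (X : set G) : graph :=
  @Graph (~` X) (fun x y => adj (val x) (val y))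
    (fun x y => @adj_sym G (val x) (val y))
    (fun x => @adj_irrefl G (val x)).

Definition isomorphic (G H : graph) : Prop :=
  exists2 f : G -> H, bijective f & forall x y, adj x y <-> adj (f x) (f y).

Definition contains_copy (Gamma G : graph) : Prop :=
  exists H : subgraph Gamma, isomorphic G H.

(* A cardinal is given by a type K of that cardinality, and "kappa pairwise
   disjoint subgraphs" are a family indexed by K. If G is the empty graph, such
   a family always exists, so the empty graph has the Erdos-Posa property. *)
Definition contains_disjoint_copies (K : Type) (Gamma G : graph) : Prop :=
  exists2 H : K -> subgraph Gamma,
    (forall i, isomorphic G (H i)) &
    trivIset [set: K] (fun i => sub_vertex (H i)).

Definition card_lt T U (A : set T) (B : set U) : Prop :=
  A #<= B /\ ~ (B #<= A).

Definition erdos_posa (K : Type) (G : graph) : Prop :=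
  forall Gamma : graph, ~ contains_disjoint_copies K Gamma G ->
  exists X : set Gamma,
    card_lt X [set: K] /\ ~ contains_copy (delete_vertices X) G.

(* Main.v *)
(* Let W be an infinite set such that K and W * W inject into W. For A in the
   power set of W there is a connected graph C_A on a fixed vertex set V of size
   |W| such that C_A embeds in C_B only if A = B, and then only by maps fixing
   certain vertices. Take G to be the disjoint union of all C_A and Gamma to be
   G together with a complete graph on K * K * V. Of two disjoint copies of G in
   Gamma, for each A at most one can have its C_A outside of the complete graph,
   so 2^|W| disjoint pieces would have to fit into the complete graph, of size
   |W|. On the other hand, deleting fewer than |K| vertices hits fewer than |K|
   of the C_A and misses some slice {k} * K * V, in which these C_A can be
   re-embedded.

   C_A encodes a labelling of the pairs of elements of W without nontrivial
   label-preserving injections, together with A. The labelling comes from a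
   well-order with a ladder for each element of cofinality omega. Colours are
   turned into graph structure by making each vertex the hub of a private wheel,
   since cycles of different lengths do not embed into each other. *)
Require Import Defs.
From mathcomp Require Import all_boot zify.
From mathcomp Require Import boolp classical_sets functions cardinality.
From mathcomp Require wochoice.

Set Implicit Arguments.
Unset Strict Implicit.
Unset Printing Implicit Defensive.

Local Open Scope classical_set_scope.

(** * Cycles on initial segments of the naturals and injections between them *)

Definition cycle_succ (n k : nat) : nat := if k.+1 < n then k.+1 else 0.

Definition cycle_adj (n k l : nat) : bool :=
  [&& k < n, l < n & (l == cycle_succ n k) || (k == cycle_succ n l)].

Lemma cycle_adjC n k l : cycle_adj n k l = cycle_adj n l k.
Proof. by rewrite /cycle_adj; lia. Qed.

Lemma cycle_adj_irrefl n k : 1 < n -> ~~ cycle_adj n k k.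
Proof. by move=> n_gt1; rewrite /cycle_adj /cycle_succ; case: ifP; lia. Qed.

Lemma cycle_adj_succ n k : 1 < n -> k < n -> cycle_adj n k (cycle_succ n k).
Proof. by move=> n_gt1 k_lt; rewrite /cycle_adj /cycle_succ; case: ifP; lia. Qed.

Lemma cycle_triangle_free n i j k : 3 < n ->
  cycle_adj n i j -> cycle_adj n i k -> cycle_adj n j k -> False.
Proof.
move=> n_gt3; rewrite /cycle_adj /cycle_succ.
by case: (ifP (i.+1 < n)); case: (ifP (j.+1 < n)); case: (ifP (k.+1 < n)); lia.
Qed.

Lemma cycle_adj_cover n i j k : cycle_adj n i j -> cycle_adj n i k -> j != k ->
  (cycle_succ n i == j) || (cycle_succ n i == k).
Proof.
rewrite /cycle_adj /cycle_succ.
by case: (ifP (i.+1 < n)); case: (ifP (j.+1 < n)); case: (ifP (k.+1 < n)); lia.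
Qed.

(** The image of [g] is closed under successor: the two neighbours of [k] have distinct images,
    which exhaust the neighbours of [g k]. Hence [g] is onto the cycle of length [m]. *)
Lemma cycle_embedding_eq n m (g : nat -> nat) : 2 < n -> 2 < m ->
  {in gtn n &, injective g} ->
  (forall k, k < n -> cycle_adj m (g k) (g (cycle_succ n k))) -> n = m.
Proof.
move=> n_gt2 m_gt2 g_inj g_adj; apply/eqP; rewrite eqn_leq; apply/andP; split.
  have: size (map g (iota 0 n)) <= size (iota 0 m); last first.
    by rewrite size_map !size_iota.
  apply: uniq_leq_size.
    rewrite map_inj_in_uniq ?iota_uniq // => i j.
    by rewrite !mem_iota !add0n; apply: g_inj.
  move=> _ /mapP[k + ->]; rewrite !mem_iota !add0n => k_lt.
  by case/and3P: (g_adj _ k_lt).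
pose img l := exists2 k, k < n & g k = l.
have img_succ l : img l -> img (cycle_succ m l).
  case=> k k_lt <-; pose p := if k is j.+1 then j else n.-1.
  have p_lt : p < n by rewrite /p; case: (k) k_lt; lia.
  have pk : cycle_succ n p = k.
    by rewrite /cycle_succ /p; case: (k) k_lt => [|j]; case: ifP; lia.
  have s_lt : cycle_succ n k < n by rewrite /cycle_succ; case: ifP; lia.
  have sp : cycle_succ n k <> p.
    by rewrite /cycle_succ /p; case: (k) k_lt => [|j]; case: ifP; lia.
  have := g_adj _ p_lt; rewrite pk cycle_adjC => adj_p.
  have neq : g (cycle_succ n k) != g p by apply/eqP => /g_inj; auto.
  by case/orP: (cycle_adj_cover (g_adj _ k_lt) adj_p neq) => /eqP ->;
    [exists (cycle_succ n k) | exists p].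
(* Repeated successors of any image point wrap around to 0. *)
have img0 : img 0.
  have img_up d : forall l, m - l <= d.+1 -> l < m -> img l -> img 0.
    elim: d => [|d IH] l ld l_lt /img_succ; rewrite /cycle_succ; case: ifP => //.
      by lia.
    by move=> Hl; apply: IH => //; lia.
  have: img (g 0) by exists 0 => //; lia.
  by apply: (img_up m); [lia | case/and3P: (g_adj 0 (ltnW (ltnW n_gt2)))].
have img_all l : l < m -> img l.
  elim: l => // l IH l_lt; have := img_succ _ (IH (ltnW l_lt)).
  by rewrite /cycle_succ l_lt.
have: size (iota 0 m) <= size (map g (iota 0 n)); last first.
  by rewrite size_map !size_iota.
apply: uniq_leq_size (iota_uniq _ _) _ => l; rewrite mem_iota add0n => /img_all.
by case=> k k_lt <-; apply: map_f; rewrite mem_iota.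
Qed.

(** * Encoding a labelling and a set as a connected graph *)

Inductive base (W : Type) := Point of W | Tail of W & W | Head of W & W.

Section Coding.
Variables (W : Type) (label : W -> W -> nat).

(** A pair [(a, b)] becomes a path from [Point a] to [Point b] whose two inner vertices record its
    direction. A tail-head edge with [a = b] would close a triangle. *)
Definition arc (u v : base W) : Prop :=
  match u, v with
  | Point x, Tail a _ => x = a
  | Tail a b, Head c d => [/\ a = c, b = d & a <> b]
  | Head _ b, Point y => b = y
  | _, _ => False
  end.

Definition base_adj u v := arc u v \/ arc v u.

Lemma base_adjC u v : base_adj u v -> base_adj v u.
Proof. by case; [right | left]. Qed.

Lemma base_adj_irrefl u : ~ base_adj u u.
Proof. by case: u => [x|x y|x y] []. Qed.

Lemma base_triangle_free u v w :
  base_adj u v -> base_adj u w -> base_adj v w -> False.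
Proof.
rewrite /base_adj.
by case: u => [x|x y|x y]; case: v => [x'|x' y'|x' y'];
  case: w => [x''|x'' y''|x'' y''] /= [] // => h1 [] // => h2 [] // => h3;
  repeat match goal with H : [/\ _, _ & _] |- _ => case: H => ??? end; congruence.
Qed.

(** The colour reveals the kind of vertex: points get 0 or 1, tails even and heads odd values from 2
    on. *)
Definition color (A : set W) (u : base W) : nat :=
  match u with
  | Point x => if `[< A x >] then 0 else 1
  | Tail x y => (label x y).*2.+2
  | Head x y => (label x y).*2.+3
  end.

(* (u, None) is the hub u of a wheel and (u, Some k) the k-th vertex of its rim;
   those with k >= color u + 4 are pendant vertices. *)
Definition code_vertex := (base W * option nat)%type.

Definition code_adj (A : set W) (s t : code_vertex) : Prop :=
  match s, t with
  | (u, None), (v, None) => base_adj u v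
  | (u, None), (v, Some _) | (u, Some _), (v, None) => u = v
  | (u, Some k), (v, Some l) => u = v /\ cycle_adj (color A u).+4 k l
  end.

Lemma code_adj_sym A s t : code_adj A s t -> code_adj A t s.
Proof.
case: s t => [u [k|]] [v [l|]] //=; last exact: base_adjC.
by case=> ->; rewrite cycle_adjC.
Qed.

Lemma code_adj_irrefl A s : ~ code_adj A s s.
Proof.
case: s => [u [k|]] /=; last exact: base_adj_irrefl.
by case=> _; apply/negP/cycle_adj_irrefl.
Qed.

(** Connectedness is phrased through maps constant along edges, ready to be applied to the component
    of an image. *)
Lemma code_connected A (T : Type) (g : code_vertex -> T) :
  (forall s t, code_adj A s t -> g s = g t) -> forall s t, g s = g t.
Proof.
move=> g_adj.
have g_point x y : g (Point x, None) = g (Point y, None).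
  have [->//|xy] := pselect (x = y).
  rewrite (g_adj (Point x, None) (Tail x y, None)); last by left.
  rewrite (g_adj (Tail x y, None) (Head x y, None)); last by left.
  by apply: g_adj; left.
have g_hub u : exists x, g (u, None) = g (Point x, None).
  case: u => [x|x y|x y]; [by exists x | exists x | exists y].
    by apply: g_adj; right.
  by apply: g_adj; left.
have g_all s : exists x, g s = g (Point x, None).
  case: s => u o; have [x gu] := g_hub u; exists x; rewrite -gu.
  by case: o => // k; apply: g_adj.
move=> s t; have [x ->] := g_all s; have [y ->] := g_all t; exact: g_point.
Qed.

Definition code_embedding A B (f : code_vertex -> code_vertex) :=
  injective f /\ forall s t, code_adj A s t -> code_adj B (f s) (f t).

(* The link of a hub of colour c consists of a cycle of length c + 4 and
   isolated vertices, whereas the link of any other vertex is a star. *)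
Lemma embedding_color A B f u : code_embedding A B f ->
  exists2 v, f (u, None) = (v, None) & color A u = color B v.
Proof.
case=> f_inj f_adj; set n := (color A u).+4.
have adj_hub k : code_adj B (f (u, None)) (f (u, Some k)) by exact: f_adj.
have adj_rim k : k < n ->
    code_adj B (f (u, Some k)) (f (u, Some (cycle_succ n k))).
  by move=> k_lt; apply: f_adj; split=> //; apply: cycle_adj_succ.
case fu: (f (u, None)) => [v [j|]].
  exfalso.
  have rim k : f (u, Some k) = (v, None) \/
      exists2 l, f (u, Some k) = (v, Some l) & cycle_adj (color B v).+4 j l.
    have := adj_hub k; rewrite fu; case: (f _) => w [l|] /= => [[<- jl]|<-].
      by right; exists l.
    by left.
  have no_edge k : k < n -> f (u, Some k) <> (v, None) ->
      f (u, Some (cycle_succ n k)) <> (v, None) -> False.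
    move=> k_lt; case: (rim k) => // -[l fl jl] _.
    case: (rim (cycle_succ n k)) => // -[l' fl' jl'] _.
    have := adj_rim k k_lt; rewrite fl fl' => -[_ ll'].
    exact: cycle_triangle_free jl jl' ll'.
  have f_neq k l : k <> l -> f (u, Some k) = (v, None) -> f (u, Some l) <> (v, None).
    by move=> kl fk; rewrite -fk => /f_inj [] /esym.
  (* At most one rim vertex goes to [(v, None)]: if it is 0 or 1, the edge from 2 to 3 avoids it,
     otherwise the edge from 0 to 1 does. *)
  have [f0|f0] := pselect (f (u, Some 0) = (v, None)).
    by apply: (@no_edge 2) => //; apply: f_neq f0.
  have [f1|f1] := pselect (f (u, Some 1) = (v, None)).
    by apply: (@no_edge 2) => //; apply: f_neq f1.
  exact: (@no_edge 0).
exists v => //.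
(* If rim vertex [k] went to a hub, its successor would yield a loop or a triangle of [base_adj]. *)
have rim k : k < n -> exists l, f (u, Some k) = (v, Some l).
  move=> k_lt; have := adj_hub k; have := adj_hub (cycle_succ n k).
  have := adj_rim k k_lt; rewrite fu.
  case: (f (u, Some k)) => w [l|] /=; first by move=> _ _ ->; exists l.
  case: (f _) => w' [l'|] /=; first by move=> -> <- /base_adj_irrefl.
  by move=> ww' vw' vw; case: (base_triangle_free vw vw' ww').
pose g k := odflt 0 (f (u, Some k)).2.
have fg k : k < n -> f (u, Some k) = (v, Some (g k)).
  by move=> /rim[l fl]; rewrite /g fl.
suff: n = (color B v).+4 by case.
apply: (@cycle_embedding_eq n _ g) => //.
  move=> k l k_lt l_lt gkl; have := fg k k_lt.
  by rewrite gkl -(fg l l_lt) => /f_inj [].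
move=> k k_lt; have := adj_rim k k_lt; rewrite !fg //; first by case.
by rewrite /cycle_succ; case: ifP.
Qed.

Lemma embedding_point A B f x : code_embedding A B f ->
  exists2 y, f (Point x, None) = (Point y, None) & A x <-> B y.
Proof.
move=> /(@embedding_color _ _ _ (Point x)) [[y|y z|y z] fx] /=;
  do ?[by case: asboolP].
by move=> c; exists y => //; move: c; do 2 case: asboolP.
Qed.

Definition label_rigid := forall f : W -> W, injective f ->
  (forall x y, x <> y -> label (f x) (f y) = label x y) -> f =1 id.

(** Colours force paths of pairs onto paths of pairs with the same label, so the induced map on
    points is the identity; the colours of points then give [A = B]. *)
Lemma embedding_rigid A B f : label_rigid -> code_embedding A B f ->
  A = B /\ forall x, f (Point x, None) = (Point x, None).
Proof.
move=> rigid fE; have [f_inj f_adj] := fE.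
have /choice[h fh] x : exists y, f (Point x, None) = (Point y, None) /\ (A x <-> B y).
  by have [y] := embedding_point x fE; exists y.
have h_id : h =1 id.
  apply: rigid => [x y hxy|x y xy].
    by have := (fh x).1; rewrite hxy -(fh y).1 => /f_inj [].
  have [t ft] := embedding_color (Tail x y) fE.
  have [d fd] := embedding_color (Head x y) fE.
  have := f_adj (Point x, None) (Tail x y, None) (or_introl erefl).
  have := f_adj (Tail x y, None) (Head x y, None)
    (or_introl (And3 erefl erefl xy)).
  have := f_adj (Head x y, None) (Point y, None) (or_introl erefl).
  rewrite ft fd (fh x).1 (fh y).1 /=.
  case: t {ft} => [t|t1 t2|t1 t2] /=; try by case: asboolP => _; lia.
    case: d {fd} => [d|d1 d2|d1 d2] /=; try by case: asboolP => _; lia.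
      by lia.
    move=> [/= <-|[]] [[/= <- <- _]|[]] [/= <-|[]] _; lia.
  by lia.
by split=> [|x]; [apply/predeqP => x; rewrite (fh x).2 | rewrite (fh x).1]; rewrite h_id.
Qed.

End Coding.

(** * Strict well-orders *)

Record strict_well_order (W : Type) (lt : W -> W -> Prop) : Prop := {
  swo_irrefl : forall x, ~ lt x x;
  swo_trans : forall x y z, lt x y -> lt y z -> lt x z;
  swo_total : forall x y, [\/ lt x y, x = y | lt y x];
  swo_min : forall P : set W, P !=set0 ->
    exists2 z, P z & forall y, P y -> ~ lt y z }.

(** The order axioms are read off from least elements of sets of one, two and three points. *)
Lemma exists_strict_well_order (T : Type) :
  exists lt : T -> T -> Prop, strict_well_order lt.
Proof.
have [R wo] := wochoice.well_ordering_principle {classic T}.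
have min (P : set T) : P !=set0 ->
    exists! z, P z /\ forall y, P y -> R z y.
  move=> [x Px]; have [|z [[Pz zP] z_uniq]] := wo [pred x | `[< P x >]].
    by exists x; apply/asboolP.
  exists z; split=> [|y [Py yP]].
    by split=> [|y Py]; [apply/asboolP | apply: zP; apply/asboolP].
  by apply: z_uniq; split=> [|u /asboolP]; [apply/asboolP | apply: yP].
have refl x : R x x by have [|_ [[-> h] _]] := min [set x]; [exists x | apply: h].
have anti x y : R x y -> R y x -> x = y.
  move=> xy yx; have [|z [_ z_uniq]] := min [set x; y]; first by exists x; left.
  rewrite -(z_uniq x) ?(z_uniq y) //; split; by [left | right | move=> _ [] ->].
have total x y : R x y \/ R y x.
  have [|_ [[[->|->] h] _]] := min [set x; y]; first by exists x; left.
    by left; apply: h; right.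
  by right; apply: h; left.
have trans x y z : R x y -> R y z -> R x z.
  move=> xy yz; have [|u [[Pu h] _]] := min [set x; y; z]; first by exists x; do 2 left.
  have ux : R u x by apply: h; do 2 left.
  have uy : R u y by apply: h; left; right.
  have uz : R u z by apply: h; right.
  case: Pu => [[|]|] uE; move: ux uy uz; rewrite uE // => zx zy _.
    by rewrite (anti _ _ xy zx).
  by rewrite -(anti _ _ yz zy).
exists (fun x y => R x y /\ x <> y); split.
- by move=> x [].
- move=> x y z [xy nxy] [yz nyz]; split; first exact: trans yz.
  by move=> xz; apply: nxy; apply: anti => //; rewrite xz.
- move=> x y; have [->|xy] := pselect (x = y); first by apply: Or32.
  by have [?|?] := total x y; [apply: Or31 | apply: Or33; split=> // /esym].
- move=> P /min[z [[Pz zP] _]]; exists z => // y Py [yz]; apply.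
  exact: anti (zP _ Py).
Qed.

Definition option_lt (T : Type) (lt : T -> T -> Prop) (u v : option T) : Prop :=
  match u, v with
  | Some x, Some y => lt x y
  | Some _, None => True
  | None, _ => False
  end.

Lemma option_strict_well_order (T : Type) (lt : T -> T -> Prop) :
  strict_well_order lt -> strict_well_order (option_lt lt).
Proof.
case=> irr tr tot min; split.
- by case=> //= x; apply: irr.
- by case=> [x|] [y|] [z|] //=; apply: tr.
- case=> [x|] [y|] /=; [|exact: Or31 | exact: Or33 | exact: Or32].
  by have [?|->|?] := tot x y; [apply: Or31 | apply: Or32 | apply: Or33].
- move=> P [u Pu]; have [[x Px]|noP] := pselect (exists x, P (Some x)).
    have [|z Pz zP] := min [set x | P (Some x)]; first by exists x.
    by exists (Some z) => //; case=> [y Py|_] //=; apply: zP.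
  by exists u => //; case=> [y Py|_] //; case: noP; exists y.
Qed.

(** * Rigid labellings from ladders *)

Definition ladder (W : Type) (lt : W -> W -> Prop) (y : W) (a : nat -> W) :=
  [/\ injective a, forall n, lt (a n) y &
      forall z, lt z y -> exists n, ~ lt (a n) z].

(* The label of (x, y) records whether x < y and, if x is the n-th rung of a
   fixed ladder converging to y, the number n. If f preserves the labels and
   moves w, then f fixes the supremum of the iterates of f at w, hence also each
   rung of its ladder; but f has no fixed point between w and that supremum. *)
Lemma exists_rigid_label (W : Type) (lt : W -> W -> Prop) (top : W) :
  strict_well_order lt -> (forall x, ~ lt top x) ->
  exists label : W -> W -> nat, label_rigid label.
Proof.
move=> [irr tr tot min] top_max.
have /choice[eta etaP] y : exists a, (exists b, ladder lt y b) -> ladder lt y a.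
  by have [[b ?]|?] := pselect (exists b, ladder lt y b); [exists b | exists (fun=> y)].
(* The label is 0 unless [x] is below [y], [k.+2] if [x] is rung [k] of the ladder at [y], and 1
   otherwise. *)
have /choice[lab labP] (p : W * W) : exists n, (lt p.1 p.2 <-> n <> 0) /\
    forall k, n = k.+2 <-> ladder lt p.2 (eta p.2) /\ eta p.2 k = p.1.
  case: p => x y /=.
  have [[k [L <-]]|noL] := pselect (exists k, ladder lt y (eta y) /\ eta y k = x).
    have [inj below _] := L; exists k.+2; split=> [//|l]; split=> [[<-]//|[_]].
    by move=> /inj ->.
  have [xy|nxy] := pselect (lt x y).
    exists 1; split=> // l; split=> // L; by case: noL; exists l.
  exists 0; split=> // l; split=> // L; by case: noL; exists l.
exists (fun x y => lab (x, y)) => f f_inj f_lab.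
have lt_neq x y : lt x y -> x <> y by move=> + xy; rewrite xy => /irr.
have mono x y : lt x y -> lt (f x) (f y).
  move=> xy; apply/(labP (_, _)).1; rewrite f_lab; last exact: lt_neq.
  by apply/(labP (_, _)).1.
have f_ge x : ~ lt (f x) x.
  move=> fx; have [|z fz z_min] := min [set x | lt (f x) x]; first by exists x.
  exact: z_min (mono _ _ fz) fz.
move=> w; apply: contrapT => fw; 
have [a a0 aS] : exists2 a : nat -> W, a 0 = w & forall n, a n.+1 = f (a n).
  by exists (fun n => iter n f w).
have a_lt n : lt (a n) (a n.+1).
  elim: n => [|n IH]; last by rewrite (aS n) (aS n.+1); apply: mono.
  by rewrite aS a0; have [|/esym|/f_ge] := tot w (f w).
have a_mono m n : m < n -> lt (a m) (a n).
  elim: n => // n IH; rewrite ltnS leq_eqVlt => /orP[/eqP -> //|/IH h].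
  exact: tr (a_lt n).
have [|s aP s_min] := min [set z | forall n, lt (a n) z].
  exists top => n; have [//|an|] := tot (a n) top; last by move/top_max.
  by have := a_lt n; rewrite an => /top_max.
have cofinal z : lt z s -> exists n, ~ lt (a n) z.
  move=> zs; apply: contrapT => /forallNP h; apply: s_min zs => n.
  exact: contrapT (h n).
have [|eta_inj eta_lt eta_cof] := etaP s.
  exists a; split=> // m n amn.
  by case: (ltngtP m n) => // /a_mono; rewrite amn => /irr.
have eta_f n : ladder lt (f s) (eta (f s)) /\ eta (f s) n = f (eta s n).
  apply/(labP (f (eta s n), f s)).2; rewrite f_lab; last exact: lt_neq.
  by apply/(labP (eta s n, s)).2; split.
(* If [s] were below [f s], the rungs at [f s] would be images of rungs at [s], hence at most some
   [a k.+1] and so below [s]: not cofinal. *)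
have fs : f s = s.
  have [/f_ge//|//|sfs] := tot (f s) s.
  have [[_ _ eta_f_cof] _] := eta_f 0; have [n] := eta_f_cof _ sfs.
  rewrite (eta_f n).2; case.
  have [k ak] := cofinal _ (eta_lt n).
  have [/mono|->|//] := tot (eta s n) (a k); rewrite -aS //.
  by move/tr; apply.
have [n xw] := eta_cof _ (aP 0).
have fx : f (eta s n) = eta s n by rewrite -(eta_f n).2 fs.
have x_ge k : ~ lt (eta s n) (a k).
  elim: k => [|k IH xa]; first by move=> xa; apply: xw.
  have [//|xE|/mono] := tot (eta s n) (a k).
    by move: xa; rewrite aS -xE fx => /irr.
  by rewrite -aS fx => /(tr _ _ _ xa) /irr.
apply: s_min (eta_lt n) => k.
have [/x_ge//|xE|//] := tot (eta s n) (a k).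
by case: (x_ge k.+1); rewrite xE.
Qed.

(** * Injections into trees, and Cantor's diagonal argument *)

Inductive tree (K : Type) := Leaf | Elt of K | Node of tree K & tree K.
Arguments Leaf {K}.

Definition tree_of_nat (K : Type) (n : nat) : tree K := iter n (Node Leaf) Leaf.

Lemma tree_of_nat_inj K : injective (@tree_of_nat K).
Proof. by elim=> [|m IH] [|n] //= [/IH ->]. Qed.

Definition tree_of_option (K T : Type) (g : T -> tree K) (u : option T) : tree K :=
  if u is Some t then Node Leaf (g t) else Leaf.

Lemma tree_of_option_inj K T (g : T -> tree K) :
  injective g -> injective (tree_of_option g).
Proof. by move=> g_inj [x|] [y|] //= [] /g_inj ->. Qed.

Definition tree_of_base (K W : Type) (g : W -> tree K) (u : base W) : tree K :=
  match u with
  | Point x => Node (tree_of_nat K 0) (g x)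
  | Tail x y => Node (tree_of_nat K 1) (Node (g x) (g y))
  | Head x y => Node (tree_of_nat K 2) (Node (g x) (g y))
  end.

Lemma tree_of_base_inj K W (g : W -> tree K) :
  injective g -> injective (tree_of_base g).
Proof.
move=> g_inj [x|x y|x y] [x'|x' y'|x' y'] //= []; first by move=> /g_inj ->.
  by move=> /g_inj -> /g_inj ->.
by move=> /g_inj -> /g_inj ->.
Qed.

Lemma powerset_not_injective (W : Type) (g : set W -> W) : ~ injective g.
Proof.
move=> g_inj; pose D := [set w | exists2 A, g A = w & ~ A w].
have [[A gA nA]|nD] := pselect (D (g D)); last by apply: (nD); exists D.
by move: (nA); rewrite (g_inj _ _ gA); apply; exists A.
Qed.

(** * Copies of a graph as images of embeddings *)

Definition graph_embedding (G Gamma : graph) (f : G -> Gamma) :=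
  injective f /\ forall x y, adj x y -> adj (f x) (f y).

(** Only images of edges are kept, so an injective [f] is an isomorphism onto it even when it does
    not reflect adjacency. *)
Definition image_subgraph (G Gamma : graph) (f : G -> Gamma)
    (f_adj : forall x y, adj x y -> adj (f x) (f y)) : subgraph Gamma.
Proof.
refine (@Subgraph Gamma (range f)
  (fun a b => exists x y, [/\ adj x y, f x = a & f y = b]) _ _ _).
- by move=> _ _ [x [y [xy <- <-]]]; apply: f_adj.
- by move=> _ _ [x [y [xy <- <-]]]; exists y, x; split=> //; apply: adj_sym.
- by move=> _ _ [x [y [_ <- _]]]; exists x.
Defined.

Lemma graph_embedding_contains_copy (G Gamma : graph) (f : G -> Gamma) :
  graph_embedding f -> contains_copy Gamma G.
Proof.
move=> [f_inj f_adj]; exists (image_subgraph f_adj).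
pose h (x : G) : image_subgraph f_adj := SigSub (mem_set (imageT f x)).
have /choice[h' h'P] (z : image_subgraph f_adj) : exists x, f x = val z.
  by have [x _ fx] := set_valP z; exists x.
exists h.
  exists h' => [x|z]; first by apply: f_inj; rewrite h'P.
  by apply: val_inj; rewrite /= h'P.
move=> x y; split=> /= [xy|]; first by exists x, y.
by case=> x' [y' [xy /f_inj <- /f_inj <-]].
Qed.

Lemma isomorphic_subgraph_embedding (G Gamma : graph) (H : subgraph Gamma) :
  isomorphic G H ->
  exists2 f : G -> Gamma, graph_embedding f & forall x, sub_vertex H (f x).
Proof.
case=> h /bij_inj h_inj h_adj; exists (fun x => val (h x)).
  split=> [x y /val_inj /h_inj //|x y /h_adj]; exact: sub_adj_adj.
by move=> x; apply: set_valP.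
Qed.

(** * The graph, its host, and the two properties of the host *)

Section Construction.
Variables (K W : Type) (label : W -> W -> nat).

Definition code_sum_adj (p q : set W * code_vertex W) :=
  p.1 = q.1 /\ code_adj label p.1 p.2 q.2.

Lemma code_sum_adj_sym p q : code_sum_adj p q -> code_sum_adj q p.
Proof. by case=> pq /code_adj_sym; rewrite pq. Qed.

Lemma code_sum_adj_irrefl p : ~ code_sum_adj p p.
Proof. by case=> _ /code_adj_irrefl. Qed.

Definition code_sum : graph := Graph code_sum_adj_sym code_sum_adj_irrefl.

(** The first [K] indexes slices; the second keeps pieces re-embedded in one slice apart. *)
Definition host_vertex : Type :=
  ((set W * code_vertex W) + K * (K * code_vertex W))%type.

Definition host_adj (p q : host_vertex) :=
  match p, q with
  | inl p, inl q => code_sum_adj p q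
  | inr p, inr q => p <> q
  | _, _ => False
  end.

Lemma host_adj_sym p q : host_adj p q -> host_adj q p.
Proof.
by case: p q => [p|p] [q|q] //=; [apply: code_sum_adj_sym | apply: nesym].
Qed.

Lemma host_adj_irrefl p : ~ host_adj p p.
Proof. by case: p => p /=; [apply: code_sum_adj_irrefl | apply]. Qed.

Definition host : graph := Graph host_adj_sym host_adj_irrefl.

Definition host_component (p : host) : option (set W) :=
  if p is inl (A, _) then Some A else None.

(** By connectedness the piece of [A] lands in one component; if that is the piece of some [B],
    rigidity applies. *)
Lemma host_embedding_dichotomy (f : code_sum -> host) (w : W) (A : set W) :
  label_rigid label -> graph_embedding f ->
  f (A, (Point w, None)) = inl (A, (Point w, None)) \/
  exists k, f (A, (Point w, None)) = inr k.
Proof.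
move=> rigid [f_inj f_adj].
have comp s : host_component (f (A, s)) = host_component (f (A, (Point w, None))).
  apply: (@code_connected _ label A _ (fun s => host_component (f (A, s)))).
  move=> {}s t st; have := f_adj (A, s) (A, t) (conj erefl st).
  by case: (f _) (f _) => [[B s']|?] [[C t']|?] //= [/= ->].
case fw: (f (A, (Point w, None))) => [[B s]|k]; last by right; exists k.
left; have /choice[h fh] t : exists s, f (A, t) = inl (B, s).
  have := comp t; rewrite fw /=; case: (f _) => [[C t']|//] [->].
  by exists t'.
have [|AB h_point] := @embedding_rigid W label A B h rigid.
  split=> [t u htu|t u tu].
    by have := fh t; rewrite htu -fh => /f_inj [].
  by have := f_adj (A, t) (A, u) (conj erefl tu); rewrite !fh => -[].
by rewrite -fw fh h_point AB.
Qed.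

(** The boolean tells which of two disjoint copies sends the point [w] of piece [A] into the
    complete graph; both cannot fix it. *)
Lemma host_no_disjoint_copies (w : W) (i j : K) :
  label_rigid label -> i <> j ->
  (forall g : set W -> (K * (K * code_vertex W)) * bool, ~ injective g) ->
  ~ contains_disjoint_copies K host code_sum.
Proof.
move=> rigid ij no_inj [H H_iso H_disj].
have [fi fi_emb fiH] := isomorphic_subgraph_embedding (H_iso i).
have [fj fj_emb fjH] := isomorphic_subgraph_embedding (H_iso j).
have disj x y : fi x <> fj y.
  move=> xy; apply: ij; apply: H_disj => //; exists (fi x); split=> //.
  by rewrite xy.
have /choice[g gP] A : exists p : (K * (K * code_vertex W)) * bool,
    (if p.2 then fi else fj) (A, (Point w, None)) = inr p.1.
  have [fiA|[k fiA]] := host_embedding_dichotomy w A rigid fi_emb; last first.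
    by exists (k, true).
  have [fjA|[k fjA]] := host_embedding_dichotomy w A rigid fj_emb; last first.
    by exists (k, false).
  by case: (disj (A, (Point w, None)) (A, (Point w, None))); rewrite fiA fjA.
apply: (no_inj g) => A B gAB; have := gP A; rewrite gAB -gP.
by case: (g B).2 => [/fi_emb.1|/fj_emb.1] [].
Qed.

Lemma host_delete (X : set host) : card_lt X [set: K] ->
  contains_copy (delete_vertices X) code_sum.
Proof.
move=> [/card_leP [iota] not_le].
(* Otherwise a deleted vertex chosen in each slice would inject [K] into [X]. *)
have [k kX] : exists k, forall q, ~ X (inr (k, q)).
  apply: contrapT => /forallNP noslice; apply: not_le.
  have /choice[g gX] k : exists q, X (inr (k, q)).
    by have /existsNP[q /contrapT] := noslice k; exists q.
  apply/card_leP/injfunPex.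
  exists (fun k : [set: K] => SigSub (mem_set (gX (val k)))) => //.
  by move=> k l _ _ /(congr1 val) [] /val_inj.
(* A deleted vertex in piece [A] determines [A], so [iota] assigns distinct damaged pieces distinct
   places in slice [k]. *)
have /choice[bad badP] A : exists x : option X,
    if x is Some x then exists s, val x = inl (A, s)
    else forall s, ~ X (inl (A, s)).
  have [[s Xs]|noX] := pselect (exists s, X (inl (A, s))).
    by exists (Some (SigSub (mem_set Xs))); exists s.
  by exists None => s Xs; apply: noX; exists s.
pose f (p : code_sum) : host :=
  if bad p.1 is Some x then inr (k, (val (iota x), p.2)) else inl p.
have fX p : ~ X (f p).
  rewrite /f; have := badP p.1; case: (bad p.1) => [x _|]; first exact: kX.
  by case: p => A s /= ; apply.
pose h (p : code_sum) : delete_vertices X := SigSub (mem_set (fX p : (~` X) (f p))).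
apply: (@graph_embedding_contains_copy _ _ h); split.
  move=> [A s] [B t] /(congr1 val) /=; rewrite /f /=.
  have := badP A; have := badP B.
  case: (bad A) (bad B) => [x|] [y|] //=; last by move=> _ _ [-> ->].
  move=> [t' yB] [s' xA] [/val_inj xy ->].
  have {}xy : x = y by apply: (@inj _ _ _ iota); rewrite ?in_setT.
  by move: xA; rewrite xy yB => -[->].
move=> [A s] [B t] [/= <- st] /=; rewrite /f /=.
case: (bad A) => //= x [ts]; move: st; rewrite ts; exact: code_adj_irrefl.
Qed.

End Construction.

Theorem theorem1p11 (K : Type) (K_uncountable : ~ countable [set: K]) :
  exists G : graph,
    ~ erdos_posa K G /\
    exists Gamma : graph,
      ~ contains_disjoint_copies K Gamma G /\
      forall X : set Gamma, card_lt X [set: K] ->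
        contains_copy (delete_vertices X) G.
Proof.
have [i [j ij]] : exists i j : K, i <> j.
  apply: contrapT => K1; apply: K_uncountable.
  have [[i _]|K0] := pselect (exists i : K, True); last first.
    apply: (sub_countable _ (countable0 K)); apply: subset_card_le => k _.
    by apply: K0; exists k.
  apply: (sub_countable _ (countable1 i)); apply: subset_card_le => k _ /=.
  by apply: contrapT => ki; apply: K1; exists k, i.
(* [Node] provides pairing, and [None] is the greatest element needed to bound iterates. *)
pose W := option (tree K).
have [lt /option_strict_well_order wo] := exists_strict_well_order (tree K).
have [label rigid] := exists_rigid_label (top := None) wo (fun x => id).
have disj : ~ contains_disjoint_copies K (host K label) (code_sum label).
  apply: (host_no_disjoint_copies None rigid ij) => g g_inj.
  have code_inj : injective (tree_of_option (@id (tree K))) by exact: tree_of_option_inj.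
  (* [tr] codes the would-be target of the power set inside [W], contradicting Cantor. *)
  pose tr (p : (K * (K * code_vertex W)) * bool) : W :=
    let: ((k, (l, (u, o))), b) := p in
    Some (Node (Node (Elt k) (Elt l)) (Node (tree_of_nat K b)
      (Node (tree_of_base (tree_of_option id) u) (tree_of_option (@tree_of_nat K) o)))).
  apply: (@powerset_not_injective W (tr \o g)); apply: inj_comp g_inj.
  move=> [[k [l [u o]]] b] [[k' [l' [u' o']]] b'] [-> -> /tree_of_nat_inj bb].
  move=> /(tree_of_base_inj code_inj) -> /(tree_of_option_inj (@tree_of_nat_inj K)) ->.
  by case: b b' bb => [] [].
have del := @host_delete K W label.
exists (code_sum label); split; last by exists (host K label).
by move=> /(_ _ disj) [X [/del]].
Qed.
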